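(* Let $k\le 0$ and let $(X,d)$ be a (non-empty) complete $\mathrm{CAT}(k)$ space. Then $X$ is an absolute retract.
   Context: For $k\le 0$, $M_k^2$ is the Euclidean plane ($k=0$) or the hyperbolic plane with its metric divided by $\sqrt{-k}$ ($k<0$). A geodesic metric space $X$ is $\mathrm{CAT}(k)$ ($k\le0$) if every geodesic triangle in $X$ has a comparison triangle in $M_k^2$ (same side lengths) such that distances between points of the triangle are at most the distances between the corresponding comparison points. A subset $A$ of a metric space $Y$ is a retract of $Y$ if there is a continuous map $f:Y\to A$ (a retraction) with $f(a)=a$ for all $a\in A$. A metric space $X$ is an absolute retract (AR) if for every embedding (homeomorphism onto its image) $h$ of $X$ into a metric space $Y$ with $h(X)$ closed in $Y$, there is a retraction of $Y$ onto $h(X)$. *)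

(* Defs.v *)
From HB Require Import structures.
From mathcomp Require Import all_boot all_order all_algebra.
From mathcomp Require Import all_classical all_reals all_analysis.
From mathcomp Require Import ring lra.

Set Implicit Arguments.
Unset Strict Implicit.
Unset Printing Implicit Defensive.

Import Order.TTheory GRing.Theory Num.Theory.

Local Open Scope classical_set_scope.
Local Open Scope ring_scope.

Section EuclideanPlane.
Variable R : realType.

(* An alias, because the library puts the sup distance on 'rV[R]_2. *)
Definition euclidean_plane : Type := 'rV[R]_2.
HB.instance Definition _ := Choice.on euclidean_plane.

Implicit Types p q r : euclidean_plane.

Definition euclid_dist p q : R :=
  Num.sqrt (\sum_(i < 2) ((p : 'rV[R]_2) 0 i - (q : 'rV[R]_2) 0 i) ^+ 2).

Lemma euclid_distE p q : euclid_dist p q =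
  Num.sqrt (((p : 'rV[R]_2) 0 0 - (q : 'rV[R]_2) 0 0) ^+ 2 +
            ((p : 'rV[R]_2) 0 1 - (q : 'rV[R]_2) 0 1) ^+ 2).
Proof.
rewrite /euclid_dist !big_ord_recl big_ord0 addr0.
by congr (Num.sqrt (_ + ((p : 'rV[R]_2) _ _ - (q : 'rV[R]_2) _ _) ^+ 2));
  exact: val_inj.
Qed.

Lemma euclid_distxx p : euclid_dist p p = 0.
Proof. by rewrite euclid_distE !subrr expr0n /= addr0 sqrtr0. Qed.

Lemma euclid_dist_positivity p q : euclid_dist p q = 0 -> p = q.
Proof.
rewrite euclid_distE => /eqP; rewrite sqrtr_eq0 => h.
apply/rowP => i.
have [] : (p : 'rV[R]_2) 0 0 = (q : 'rV[R]_2) 0 0 /\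
          (p : 'rV[R]_2) 0 1 = (q : 'rV[R]_2) 0 1.
  have a0 := sqr_ge0 ((p : 'rV[R]_2) 0 0 - (q : 'rV[R]_2) 0 0).
  have b0 := sqr_ge0 ((p : 'rV[R]_2) 0 1 - (q : 'rV[R]_2) 0 1).
  by split; apply/eqP; rewrite -subr_eq0 -sqrf_eq0; apply/eqP; lra.
by case: i => -[|[|//]] hi h0 h1; [move: h0|move: h1]; congr (_ = _);
  congr (fun_of_matrix _ _ _); exact: val_inj.
Qed.

Lemma euclid_dist_sym p q : euclid_dist p q = euclid_dist q p.
Proof. by rewrite !euclid_distE; congr Num.sqrt; ring. Qed.

Lemma sqrt_minkowski (a b c d : R) :
  Num.sqrt ((a + c) ^+ 2 + (b + d) ^+ 2) <=
  Num.sqrt (a ^+ 2 + b ^+ 2) + Num.sqrt (c ^+ 2 + d ^+ 2).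
Proof.
set s := Num.sqrt (a ^+ 2 + b ^+ 2); set t := Num.sqrt (c ^+ 2 + d ^+ 2).
have s0 : 0 <= s := sqrtr_ge0 _.
have t0 : 0 <= t := sqrtr_ge0 _.
have s2 : s ^+ 2 = a ^+ 2 + b ^+ 2 by rewrite sqr_sqrtr // addr_ge0 ?sqr_ge0.
have t2 : t ^+ 2 = c ^+ 2 + d ^+ 2 by rewrite sqr_sqrtr // addr_ge0 ?sqr_ge0.
have cs : a * c + b * d <= s * t.
  apply: (le_trans (ler_norm _)).
  rewrite -(@ler_pXn2r _ 2) // ?nnegrE ?mulr_ge0 //.
  rewrite real_normK ?num_real // exprMn s2 t2 -subr_ge0.
  have -> : (a ^+ 2 + b ^+ 2) * (c ^+ 2 + d ^+ 2) - (a * c + b * d) ^+ 2 =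
    (a * d - b * c) ^+ 2 by ring.
  exact: sqr_ge0.
rewrite -(@ler_pXn2r _ 2) // ?nnegrE ?sqrtr_ge0 ?addr_ge0 //.
rewrite sqr_sqrtr ?addr_ge0 ?sqr_ge0 //.
have -> : (s + t) ^+ 2 = s ^+ 2 + t ^+ 2 + 2 * (s * t) by ring.
rewrite s2 t2; nra.
Qed.

Lemma euclid_dist_triangle q p r : euclid_dist p r <= euclid_dist p q + euclid_dist q r.
Proof.
rewrite !euclid_distE; apply: le_trans (sqrt_minkowski _ _ _ _).
by rewrite !addrA !subrK.
Qed.

HB.instance Definition _ := isMetric.Build R euclidean_plane
  euclid_distxx euclid_dist_positivity euclid_dist_sym euclid_dist_triangle.

End EuclideanPlane.

Section HyperbolicPlane.
Variable R : realType.

Definition cosh (x : R) : R := (expR x + expR (- x)) / 2.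
Definition arcosh (z : R) : R := ln (z + Num.sqrt (z ^+ 2 - 1)).

Definition lorentz (u v : 'rV[R]_3) : R :=
  u 0 0 * v 0 0 + u 0 1 * v 0 1 - u 0 2 * v 0 2.

(* The upper sheet of the hyperboloid <u|u> = -1 in Minkowski 3-space. *)
Definition hyperboloid : Type :=
  {u : 'rV[R]_3 | (lorentz u u == -1) && (0 < u 0 2)}.

Implicit Types u v w : hyperboloid.

Definition hdist u v : R := arcosh (- lorentz (val u) (val v)).

Let sq (z : R) := Num.sqrt (z ^+ 2 - 1).

Let sqK (z : R) : 1 <= z -> sq z ^+ 2 = z ^+ 2 - 1.
Proof. by move=> z1; rewrite sqr_sqrtr // subr_ge0 expr_ge1 // (le_trans ler01). Qed.

Lemma cosh_arcosh (z : R) : 1 <= z -> cosh (arcosh z) = z.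
Proof.
move=> z1; have s0 : 0 <= sq z := sqrtr_ge0 _.
have p : 0 < z + sq z by lra.
have s2 := sqK z1.
rewrite /cosh expRN /arcosh lnK ?posrE // -/(sq z).
have -> : (z + sq z)^-1 = z - sq z.
  apply: (mulfI (lt0r_neq0 p)); rewrite divff ?lt0r_neq0 //.
  by rewrite mulrC -subr_sqr s2; ring.
by field.
Qed.

Lemma arcosh_ge0 (z : R) : 1 <= z -> 0 <= arcosh z.
Proof. by move=> z1; rewrite ln_ge0 // (le_trans z1) // lerDl sqrtr_ge0. Qed.

Lemma arcosh1 : arcosh 1 = 0.
Proof. by rewrite /arcosh expr1n subrr sqrtr0 addr0 ln1. Qed.

Lemma arcosh_eq0 (z : R) : 1 <= z -> arcosh z = 0 -> z = 1.
Proof.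
move=> z1 h; rewrite -(cosh_arcosh z1) h /cosh oppr0 expR0; by field.
Qed.

Lemma arcosh_subadd (a b c : R) : 1 <= a -> 1 <= b -> 1 <= c ->
  (c - a * b) ^+ 2 <= (a ^+ 2 - 1) * (b ^+ 2 - 1) ->
  arcosh c <= arcosh a + arcosh b.
Proof.
move=> a1 b1 c1 h.
have sa := sqK a1; have sb := sqK b1; have sc := sqK c1.
have sa0 : 0 <= sq a := sqrtr_ge0 _.
have sb0 : 0 <= sq b := sqrtr_ge0 _.
have sc0 : 0 <= sq c := sqrtr_ge0 _.
have pa : 0 < a + sq a by lra.
have pb : 0 < b + sq b by lra.
have pc : 0 < c + sq c by lra.
have ch : c <= a * b + sq a * sq b.
  rewrite -lerBlDl; apply: (le_trans (ler_norm _)).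
  rewrite -(@ler_pXn2r _ 2) // ?nnegrE ?mulr_ge0 //.
  by rewrite real_normK ?num_real // exprMn sa sb.
have sch : sq c <= a * sq b + b * sq a.
  have ab0 : 0 <= a * sq b + b * sq a by rewrite addr_ge0 // mulr_ge0 //; lra.
  rewrite -(@ler_pXn2r _ 2) // ?nnegrE // sc.
  have -> : (a * sq b + b * sq a) ^+ 2 = (a * b + sq a * sq b) ^+ 2 - 1.
    have -> : (a * sq b + b * sq a) ^+ 2 =
      a ^+ 2 * sq b ^+ 2 + b ^+ 2 * sq a ^+ 2 + 2 * a * b * sq a * sq b by ring.
    have -> : (a * b + sq a * sq b) ^+ 2 =
      a ^+ 2 * b ^+ 2 + sq a ^+ 2 * sq b ^+ 2 + 2 * a * b * sq a * sq b by ring.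
    by rewrite sa sb; ring.
  rewrite lerD2r ler_pXn2r // nnegrE; first lra.
  by rewrite addr_ge0 // mulr_ge0 //; lra.
rewrite /arcosh -lnM ?posrE // ler_ln ?posrE ?mulr_gt0 // -!/(sq _).
have -> : (a + sq a) * (b + sq b) =
  (a * b + sq a * sq b) + (a * sq b + b * sq a) by ring.
exact: lerD.
Qed.

Lemma lorentz_sym (u v : 'rV[R]_3) : lorentz u v = lorentz v u.
Proof. by rewrite /lorentz; ring. Qed.

Let hypE u : (val u) 0 2 ^+ 2 = 1 + (val u) 0 0 ^+ 2 + (val u) 0 1 ^+ 2.
Proof. by case: u => u /= /andP[/eqP]; rewrite /lorentz => h _; nra. Qed.

Let hyp_gt0 u : 0 < (val u) 0 2.
Proof. by case: u => u /= /andP[]. Qed.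

(* Lagrange's identity on the hyperboloid *)
Let lagrange u v :
  ((val u) 0 2 * (val v) 0 2) ^+ 2 =
  (1 + (val u) 0 0 * (val v) 0 0 + (val u) 0 1 * (val v) 0 1) ^+ 2 +
  ((val u) 0 0 - (val v) 0 0) ^+ 2 + ((val u) 0 1 - (val v) 0 1) ^+ 2 +
  ((val u) 0 0 * (val v) 0 1 - (val u) 0 1 * (val v) 0 0) ^+ 2.
Proof. by rewrite exprMn !hypE; ring. Qed.

Lemma lorentz_ge1 u v : 1 <= - lorentz (val u) (val v).
Proof.
have L := lagrange u v.
have p : 0 < (val u) 0 2 * (val v) 0 2 by rewrite mulr_gt0.
rewrite /lorentz.
suff : 1 + (val u) 0 0 * (val v) 0 0 + (val u) 0 1 * (val v) 0 1 <=
  (val u) 0 2 * (val v) 0 2 by lra.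
apply: (le_trans (ler_norm _)).
rewrite -(@ler_pXn2r _ 2) // ?nnegrE ?(ltW p) //.
rewrite real_normK ?num_real // L -!addrA lerDl.
by rewrite !addr_ge0 // sqr_ge0.
Qed.

(* The distance is the unique nonnegative real with cosh d(u,v) = -<u|v>. *)
Lemma cosh_hdist u v : cosh (hdist u v) = - lorentz (val u) (val v).
Proof. exact/cosh_arcosh/lorentz_ge1. Qed.

Lemma hdist_ge0 u v : 0 <= hdist u v.
Proof. exact/arcosh_ge0/lorentz_ge1. Qed.

Lemma hdistxx u : hdist u u = 0.
Proof. by case: u => u /= h; rewrite /hdist/= (eqP (andP h).1) opprK arcosh1. Qed.

Lemma hdist_sym u v : hdist u v = hdist v u.
Proof. by rewrite /hdist lorentz_sym. Qed.

Lemma hdist_positivity u v : hdist u v = 0 -> u = v.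
Proof.
move/(arcosh_eq0 (lorentz_ge1 u v)) => h.
have L := lagrange u v; have Eu := hypE u; have Ev := hypE v.
have pu := hyp_gt0 u; have pv := hyp_gt0 v.
have e : (val u) 0 2 * (val v) 0 2 =
  1 + (val u) 0 0 * (val v) 0 0 + (val u) 0 1 * (val v) 0 1.
  by move: h; rewrite /lorentz; lra.
rewrite e in L.
have s0 := sqr_ge0 ((val u) 0 0 - (val v) 0 0).
have s1 := sqr_ge0 ((val u) 0 1 - (val v) 0 1).
have s2 := sqr_ge0 ((val u) 0 0 * (val v) 0 1 - (val u) 0 1 * (val v) 0 0).
have e0 : (val u) 0 0 = (val v) 0 0.
  by apply/eqP; rewrite -subr_eq0 -sqrf_eq0; apply/eqP; lra.
have e1 : (val u) 0 1 = (val v) 0 1.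
  by apply/eqP; rewrite -subr_eq0 -sqrf_eq0; apply/eqP; lra.
have e2 : (val u) 0 2 = (val v) 0 2.
  apply: (@pexpIrn _ 2) => //; rewrite ?nnegrE ?ltW //.
  by rewrite Eu Ev e0 e1.
apply: val_inj; apply/rowP => i.
by case: i => -[|[|[|//]]] hi; [move: e0|move: e1|move: e2]; congr (_ = _);
  congr (fun_of_matrix _ _ _); exact: val_inj.
Qed.

Lemma hdist_triangle v u w : hdist u w <= hdist u v + hdist v w.
Proof.
apply: arcosh_subadd; rewrite ?lorentz_ge1 //.
have Eu := hypE u; have Ev := hypE v; have Ew := hypE w.
rewrite -subr_ge0 /lorentz.
move: ((val u) 0 0) ((val u) 0 1) ((val u) 0 2) Eu => a b c Ec.
move: ((val v) 0 0) ((val v) 0 1) ((val v) 0 2) Ev => a' b' c' Ec'.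
move: ((val w) 0 0) ((val w) 0 1) ((val w) 0 2) Ew => a'' b'' c'' Ec''.
(* the Gram determinant of u, v, w is minus the square of det (u, v, w) *)
set D := (X in 0 <= X).
suff -> : D = (a * (b' * c'' - c' * b'') - b * (a' * c'' - c' * a'')
               + c * (a' * b'' - b' * a'')) ^+ 2 by exact: sqr_ge0.
pose qu := a ^+ 2 + b ^+ 2 - c ^+ 2; pose qv := a' ^+ 2 + b' ^+ 2 - c' ^+ 2.
pose qw := a'' ^+ 2 + b'' ^+ 2 - c'' ^+ 2.
have hu : qu = -1 by rewrite /qu; lra.
have hv : qv = -1 by rewrite /qv; lra.
have hw : qw = -1 by rewrite /qw; lra.
pose x := a * a' + b * b' - c * c'; pose y := a' * a'' + b' * b'' - c' * c''.
pose z := a * a'' + b * b'' - c * c''.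
have -> : D = - (qu * (qv * qw - y ^+ 2) - x * (x * qw - y * z)
                 + z * (x * y - qv * z)).
  by rewrite hu hv hw /D -/x -/y -/z; ring.
by rewrite /qu /qv /qw /x /y /z; ring.
Qed.

HB.instance Definition _ := Choice.on hyperboloid.

(* The plane of constant curvature k: the metric of the hyperboloid, which
   has curvature -1, divided by sqrt (-k).  The sign proof is carried by the
   type because the division yields a metric only for k < 0. *)
Definition hyperbolic_plane (k : R) (hk : k < 0) : Type := hyperboloid.

Section Instances.
Variables (k : R) (hk : k < 0).

HB.instance Definition _ := Choice.on (hyperbolic_plane hk).

Definition scaled_hdist (u v : hyperbolic_plane hk) : R :=
  hdist u v / Num.sqrt (- k).

Let sk_gt0 : 0 < Num.sqrt (- k).
Proof. by rewrite sqrtr_gt0 oppr_gt0. Qed.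

Lemma scaled_hdistxx u : scaled_hdist u u = 0.
Proof. by rewrite /scaled_hdist hdistxx mul0r. Qed.

Lemma scaled_hdist_positivity u v : scaled_hdist u v = 0 -> u = v.
Proof.
move/eqP; rewrite /scaled_hdist mulf_eq0 invr_eq0 (gt_eqF sk_gt0) orbF.
by move/eqP/hdist_positivity.
Qed.

Lemma scaled_hdist_sym u v : scaled_hdist u v = scaled_hdist v u.
Proof. by rewrite /scaled_hdist hdist_sym. Qed.

Lemma scaled_hdist_triangle v u w :
  scaled_hdist u w <= scaled_hdist u v + scaled_hdist v w.
Proof. by rewrite -mulrDl ler_pM2r ?invr_gt0 // hdist_triangle. Qed.

HB.instance Definition _ := isMetric.Build R (hyperbolic_plane hk)
  scaled_hdistxx scaled_hdist_positivity scaled_hdist_sym scaled_hdist_triangle.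

End Instances.
End HyperbolicPlane.

(* The model plane M_k^2, meaningful for k <= 0 only. *)
Definition model_plane (R : realType) (k : R) : metricType R :=
  match @idP (k < 0) with
  | ReflectT hk => hyperbolic_plane hk
  | ReflectF _ => euclidean_plane R
  end.

Lemma model_plane0 (R : realType) : model_plane (0 : R) = euclidean_plane R.
Proof. by rewrite /model_plane; case: {-}_ / idP => // h; have := h; rewrite ltxx. Qed.

Lemma model_plane_lt0 (R : realType) (k : R) (hk : k < 0) :
  model_plane k = hyperbolic_plane hk.
Proof.
rewrite /model_plane; case: {-}_ / idP => // h.
by rewrite (bool_irrelevance h hk).
Qed.

Section CAT.
Variable R : realType.

(* c is used on [0, d(p,q)] only, where it is an isometric embedding. *)
Definition geodesic (M : metricType R) (p q : M) (c : R -> M) : Prop :=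
  [/\ c 0 = p, c (mdist p q) = q &
      {in `[0, mdist p q] &, forall s t, mdist (c s) (c t) = `|s - t|}].

Definition geodesic_space (M : metricType R) : Prop :=
  forall p q : M, exists c, geodesic p q c.

(* Three vertices p_0, p_1, p_2 and a choice of geodesics from p_i to p_(i+1),
   indices modulo 3. *)
Record geodesic_triangle (M : metricType R) := GeodesicTriangle {
  vertex : 'I_3 -> M ;
  side : 'I_3 -> R -> M ;
  sideP : forall i, geodesic (vertex i) (vertex (ordS i)) (side i) }.

Definition side_length (M : metricType R) (T : geodesic_triangle M) (i : 'I_3) :=
  mdist (vertex T i) (vertex T (ordS i)).

Definition comparison_triangle (M N : metricType R)
    (T : geodesic_triangle M) (T' : geodesic_triangle N) : Prop :=
  forall i, side_length T' i = side_length T i.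

(* Sides being parametrized by arc length, the comparison point of the point
   side T i s is side T' i s. *)
Definition comparison_inequality (M N : metricType R)
    (T : geodesic_triangle M) (T' : geodesic_triangle N) : Prop :=
  forall i j s t, s \in `[0, side_length T i] -> t \in `[0, side_length T j] ->
    mdist (side T i s) (side T j t) <= mdist (side T' i s) (side T' j t).

Definition CAT (k : R) (X : metricType R) : Prop :=
  geodesic_space X /\
  forall T : geodesic_triangle X, exists T' : geodesic_triangle (model_plane k),
    comparison_triangle T T' /\ comparison_inequality T T'.

Definition complete_metric (X : metricType R) : Prop :=
  forall u : nat -> X, cauchy (u @ \oo) -> exists x : X, u @ \oo --> x.

End CAT.

(* A set A is coerced to the type of its elements, with the subspace
   topology. *)
Definition is_retract (Y : topologicalType) (A : set Y) : Prop :=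
  exists f : Y -> A, continuous f /\ forall a : A, f (set_val a) = a.

Definition homeomorphism (S T : topologicalType) (f : S -> T) : Prop :=
  continuous f /\ exists g : T -> S, [/\ continuous g, cancel f g & cancel g f].

Definition corestrict (S T : Type) (f : S -> T) (x : S) : range f :=
  SigSub (mem_set (imageT f x)).

Definition is_embedding (S T : topologicalType) (f : S -> T) : Prop :=
  homeomorphism (corestrict f).

Definition absolute_retract (R : realType) (X : metricType R) : Prop :=
  forall (Y : metricType R) (h : X -> Y),
    is_embedding h -> closed (range h) -> is_retract (range h).

(* Main.v *)
Require Import Defs.
From HB Require Import structures.
From mathcomp Require Import all_boot all_order all_algebra.
From mathcomp Require Import all_classical all_reals all_analysis.
From mathcomp Require Import ring lra.
Import Order.TTheory GRing.Theory Num.Theory.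
Import numFieldNormedType.Exports.
Local Open Scope classical_set_scope.
Local Open Scope ring_scope.

Set Implicit Arguments.
Unset Strict Implicit.
Unset Printing Implicit Defensive.

(** An absolute retract is obtained by extending the inverse of the closed
embedding [h : X -> Y] to a continuous map [f : Y -> X]; then [h \o f] is the
retraction.  Off the image, [f y] is the minimizer of one explicit functional
on [X], so that no partition of unity is involved.

Fix [x0] in [X], write [delta y] for the distance from [y] to the image, and set

  [functional y x = delta y ^+ 2 * G (mdist x0 x)
                    + sup_b weight y b * mdist x b],

  [weight y b = max(0, 2 delta y - mdist y (h b)) / (1 + mdist x0 b)].

Only the points [b] with [h b] at distance less than [2 delta y] from [y] have a
positive weight, so the supremum draws the minimizer towards those [b]; the
denominator keeps it finite although [X] may be unbounded.

Nonpositive curvature enters through midpoints.  Distance functions are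
midpoint convex, hence so is the supremum; and for a suitable increasing [G]
(a square in the flat case, a hyperbolic cosine in the hyperbolic case) the
function [x |-> G (mdist x0 x)] is uniformly convex.  Both facts follow from a
formula for the medians of triangles in the model plane ([euclid_median],
[hyperboloid_median]) and are carried to [X] by comparison
([CAT_midpoint_map]).  On a complete space a uniformly
convex functional attains its minimum ([uniformly_convex_argmin]), at a point
which is unique and stable under perturbation: this gives [f] and its
continuity off the image ([argmin_continuous_off]).

When [y] tends to [h a], every [b] of positive weight tends to [a], so the
supremum is [o(delta y)] at [a], whereas it is at least a constant multiple of
[delta y * mdist a x], up to [o(delta y)], at any [x].  The regularizing term
carries the factor [delta y ^+ 2] and is negligible, so the minimizer tends to
[a] ([argmin_continuous_on]). *)

(** * Convexity along midpoints *)

Section Gauges.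
Variable R : realType.

Definition midpoint (M : metricType R) (p q m : M) : Prop :=
  mdist p m = mdist p q / 2 /\ mdist m q = mdist p q / 2.

Definition midpoint_convex (M : metricType R) : Prop :=
  forall p q m z : M, midpoint p q m ->
    mdist z m <= (mdist z p + mdist z q) / 2.

(** The gain [eta] depends on the length of [pq] only: neither on the apex [z]
nor on the position of [pq]. *)
Definition midpoint_uniformly_convex (M : metricType R) (G : R -> R) : Prop :=
  forall e : R, 0 < e -> exists2 eta : R, 0 < eta &
    forall p q m z : M, midpoint p q m -> e <= mdist p q ->
      G (mdist z m) <= (G (mdist z p) + G (mdist z q)) / 2 - eta.

(** Monotonicity lets the comparison inequality pass through [G]; the lower
bound turns a bound on [G (mdist x0 x)] into one on [mdist x0 x], which makes
the sublevel sets bounded. *)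
Record gauge (G : R -> R) : Prop := Gauge {
  gauge_continuous : continuous G ;
  gauge_le : forall r s, 0 <= r -> r <= s -> G r <= G s ;
  gauge_ge_id : forall r, 0 <= r -> r <= G r }.

End Gauges.

(** * The Euclidean plane *)

Section Euclidean.
Variable R : realType.
Implicit Types p q m z : euclidean_plane R.

Lemma euclid_dist_sqr p q : mdist p q ^+ 2 =
  ((p : 'rV[R]_2) 0 0 - (q : 'rV[R]_2) 0 0) ^+ 2 +
  ((p : 'rV[R]_2) 0 1 - (q : 'rV[R]_2) 0 1) ^+ 2.
Proof.
rewrite -[mdist p q]/(euclid_dist p q) euclid_distE sqr_sqrtr //.
by rewrite addr_ge0 ?sqr_ge0.
Qed.

(** Apollonius' formula.  The parallelogram law forces a metric midpoint to be
the barycenter of the endpoints, after which the formula is an identity. *)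
Lemma euclid_median p q m z : midpoint p q m ->
  mdist z m ^+ 2 = (mdist z p ^+ 2 + mdist z q ^+ 2) / 2 - mdist p q ^+ 2 / 4.
Proof.
case=> hp hq.
have {}hp : mdist p m ^+ 2 = mdist p q ^+ 2 / 4 by rewrite hp; field.
have {}hq : mdist m q ^+ 2 = mdist p q ^+ 2 / 4 by rewrite hq; field.
move: hp hq; rewrite !euclid_dist_sqr.
move: ((p : 'rV[R]_2) 0 0) ((p : 'rV[R]_2) 0 1) => p0 p1.
move: ((q : 'rV[R]_2) 0 0) ((q : 'rV[R]_2) 0 1) => q0 q1.
move: ((m : 'rV[R]_2) 0 0) ((m : 'rV[R]_2) 0 1) => m0 m1.
move: ((z : 'rV[R]_2) 0 0) ((z : 'rV[R]_2) 0 1) => z0 z1 hp hq.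
have h : (p0 + q0 - 2 * m0) ^+ 2 + (p1 + q1 - 2 * m1) ^+ 2 = 0.
  transitivity (2 * ((p0 - m0) ^+ 2 + (p1 - m1) ^+ 2)
    + 2 * ((m0 - q0) ^+ 2 + (m1 - q1) ^+ 2)
    - ((p0 - q0) ^+ 2 + (p1 - q1) ^+ 2)); first by ring.
  by rewrite hp hq; field.
have a0 := sqr_ge0 (p0 + q0 - 2 * m0); have a1 := sqr_ge0 (p1 + q1 - 2 * m1).
have /eqP := h; rewrite paddr_eq0 // !sqrf_eq0 => /andP[/eqP e0 /eqP e1].
have -> : m0 = (p0 + q0) / 2 by lra.
have -> : m1 = (p1 + q1) / 2 by lra.
by field.
Qed.

(** Since [mdist p q] is at least the difference of the two other sides, the
squared median is at most the square of their mean. *)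
Lemma euclid_midpoint_convex : midpoint_convex (euclidean_plane R).
Proof.
move=> p q m z /(euclid_median z) h.
have t2 := metric_triangle z p q.
have t3 := metric_triangle z q p.
rewrite (metric_sym q p) in t3.
have d0 : 0 <= (mdist z p + mdist z q) / 2.
  by rewrite divr_ge0 // addr_ge0 ?mdist_ge0.
rewrite -(@ler_pXn2r _ 2) ?nnegrE ?mdist_ge0 // h.
move: (mdist z p) (mdist z q) (mdist p q) t2 t3 => x y d t2 t3.
have : 0 <= (d - x + y) * (d - y + x) by apply: mulr_ge0; lra.
by nra.
Qed.

Lemma euclid_gauge : gauge (fun r : R => 1 + r ^+ 2).
Proof.
split=> [r|r s r0 rs|r r0]; last by nra.
  by apply: cvgD; [exact: cvg_cst|exact: exprn_continuous].
by nra.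
Qed.

Lemma euclid_uniformly_convex :
  midpoint_uniformly_convex (euclidean_plane R) (fun r => 1 + r ^+ 2).
Proof.
move=> e e0; exists (e ^+ 2 / 4) => [|p q m z mpq epq].
  by rewrite divr_gt0 // exprn_gt0.
rewrite (euclid_median z mpq).
have : e ^+ 2 <= mdist p q ^+ 2 by rewrite ler_pXn2r // nnegrE ?mdist_ge0 // ltW.
lra.
Qed.

End Euclidean.

(** * The hyperbolic plane *)

Section Hyperbolic.
Variable R : realType.

Lemma cosh_ge1 (x : R) : 1 <= cosh x.
Proof.
rewrite /cosh expRN; have := expR_gt0 x; move: (expR x) => a a0.
have -> : (a + a^-1) / 2 = 1 + (a - 1) ^+ 2 / (2 * a) by field; lra.
by rewrite lerDl divr_ge0 ?sqr_ge0 //; lra.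
Qed.

Lemma ltr_cosh (x y : R) : 0 <= x -> x < y -> cosh x < cosh y.
Proof.
move=> x0 xy; rewrite /cosh !expRN ltr_pM2r ?invr_gt0 //.
have : 1 <= expR x by rewrite -expR0 ler_expR.
have : expR x < expR y by rewrite ltr_expR.
move: (expR x) (expR y) => a b ab a1.
have b0 : 0 < b by lra.
rewrite -subr_gt0.
have -> : b + b^-1 - (a + a^-1) = (b - a) * (a * b - 1) / (a * b).
  by field; apply/andP; split; lra.
by rewrite divr_gt0 // mulr_gt0; nra.
Qed.

Lemma ler_cosh (x y : R) : 0 <= x -> 0 <= y -> (cosh x <= cosh y) = (x <= y).
Proof.
move=> x0 y0; case: (leP x y) => [|yx]; last first.
  by apply/negbTE; rewrite -ltNge ltr_cosh.
by rewrite le_eqVlt => /predU1P[->|/(ltr_cosh x0)/ltW] //; rewrite lexx.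
Qed.

Lemma cosh_norm (x : R) : cosh `|x| = cosh x.
Proof.
by case: (ger0P x) => // _; rewrite /cosh opprK addrC.
Qed.

Lemma cosh_double (x : R) : cosh (2 * x) = 2 * cosh x ^+ 2 - 1.
Proof.
rewrite /cosh -mulrN !mulr2n !mulrDl !mul1r !expRD !expRN.
by field; rewrite gt_eqF // expR_gt0.
Qed.

Lemma coshD_prod (x y : R) :
  cosh x + cosh y = 2 * (cosh ((x + y) / 2) * cosh ((x - y) / 2)).
Proof.
have hx : x = (x + y) / 2 + (x - y) / 2 by field.
have hy : y = (x + y) / 2 - (x - y) / 2 by field.
move: ((x + y) / 2) ((x - y) / 2) hx hy => a b -> ->.
rewrite /cosh opprB opprD !expRD !expRN.
by field; rewrite !gt_eqF // expR_gt0.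
Qed.

Lemma cosh_continuous : continuous (@cosh R).
Proof.
move=> x; apply: cvgM; last exact: cvg_cst.
apply: cvgD; first exact: continuous_expR.
by apply: continuous_comp; [exact: continuousN|exact: continuous_expR].
Qed.

Implicit Types p q m z : hyperboloid R.

(** The difference [w] of the two sides is a null vector orthogonal to [m].  The
Lorentz form is positive definite on the orthogonal complement of the timelike
vector [m], so [w = 0]. *)
Lemma hyperboloid_midpoint p q m :
  hdist p m = hdist p q / 2 -> hdist m q = hdist p q / 2 ->
  val p + val q = (2 * cosh (hdist p q / 2)) *: val m.
Proof.
move=> hp hq; set C := cosh _.
have pm : lorentz (val p) (val m) = - C by rewrite /C -hp cosh_hdist opprK.
have mq : lorentz (val m) (val q) = - C by rewrite /C -hq cosh_hdist opprK.
have pq : lorentz (val p) (val q) = 1 - 2 * C ^+ 2.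
  rewrite -[LHS]opprK -cosh_hdist.
  have -> : hdist p q = 2 * (hdist p q / 2) by field.
  by rewrite cosh_double -/C; ring.
have pp : lorentz (val p) (val p) = -1 by case: (p) => ? /= /andP[/eqP].
have qq : lorentz (val q) (val q) = -1 by case: (q) => ? /= /andP[/eqP].
have mm : lorentz (val m) (val m) = -1 by case: (m) => ? /= /andP[/eqP].
apply/eqP; rewrite -subr_eq0; apply/eqP.
set w := _ - _.
have ww : lorentz w w = 0.
  transitivity (lorentz (val p) (val p) + lorentz (val q) (val q)
    + 4 * C ^+ 2 * lorentz (val m) (val m) + 2 * lorentz (val p) (val q)
    - 4 * C * lorentz (val p) (val m) - 4 * C * lorentz (val m) (val q)).
    by rewrite /lorentz /w !mxE; ring.
  by rewrite pp qq mm pq pm mq; ring.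
have wm : lorentz w (val m) = 0.
  transitivity (lorentz (val p) (val m) + lorentz (val m) (val q)
    - 2 * C * lorentz (val m) (val m)).
    by rewrite /lorentz /w !mxE; ring.
  by rewrite pm mq mm; ring.
have [w0 w1 w2] : [/\ w 0 0 = 0, w 0 1 = 0 & w 0 2 = 0].
  move: ww wm mm; rewrite /lorentz.
  move: (w 0 0) (w 0 1) (w 0 2) => a b c.
  move: ((val m) 0 0) ((val m) 0 1) ((val m) 0 2) => a' b' c' ww wm mm.
  (* Lagrange's identity for the spacelike coordinates of w and m *)
  have h : c ^+ 2 + (a * b' - b * a') ^+ 2 = 0.
    transitivity ((a * a + b * b) * (a' * a' + b' * b') - (a * a' + b * b') ^+ 2 + c ^+ 2).
      by ring.
    have -> : a * a + b * b = c * c by lra.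
    have -> : a' * a' + b' * b' = c' * c' - 1 by lra.
    have -> : a * a' + b * b' = c * c' by lra.
    by ring.
  have c0 : c = 0.
    move/eqP: h; rewrite paddr_eq0 ?sqr_ge0 // sqrf_eq0.
    by case/andP=> /eqP.
  move: ww; rewrite c0 mul0r subr0 => /eqP.
  by rewrite paddr_eq0 -?expr2 ?sqr_ge0 // !sqrf_eq0 => /andP[/eqP-> /eqP->].
apply/rowP => i; rewrite [RHS]mxE.
by case: i => -[|[|[|//]]] hi; [rewrite -w0|rewrite -w1|rewrite -w2];
  congr (fun_of_matrix _ _ _); exact: val_inj.
Qed.

(** The hyperbolic cosine of the distance to [z] is minus the Lorentz product
with [z], hence linear: this is [hyperboloid_midpoint] paired with [z]. *)
Lemma hyperboloid_median p q m z :
  hdist p m = hdist p q / 2 -> hdist m q = hdist p q / 2 ->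
  cosh (hdist z p) + cosh (hdist z q) =
    2 * cosh (hdist p q / 2) * cosh (hdist z m).
Proof.
move=> hp hq; have h := hyperboloid_midpoint hp hq.
set C := cosh (hdist p q / 2) in h *.
rewrite !cosh_hdist.
have h0 : (val p) 0 0 + (val q) 0 0 = 2 * C * (val m) 0 0.
  by move/rowP: h => /(_ 0); rewrite !mxE.
have h1 : (val p) 0 1 + (val q) 0 1 = 2 * C * (val m) 0 1.
  by move/rowP: h => /(_ 1); rewrite !mxE.
have h2 : (val p) 0 2 + (val q) 0 2 = 2 * C * (val m) 0 2.
  by move/rowP: h => /(_ 2); rewrite !mxE.
transitivity (- ((val z) 0 0 * ((val p) 0 0 + (val q) 0 0) +
  (val z) 0 1 * ((val p) 0 1 + (val q) 0 1) -
  (val z) 0 2 * ((val p) 0 2 + (val q) 0 2))); first by rewrite /lorentz; ring.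
by rewrite h0 h1 h2 /lorentz; ring.
Qed.

(** With [x], [y] the two sides at [z] and [e] half of the third one, the median
formula reads
[cosh ((x + y) / 2) * cosh ((x - y) / 2) = cosh e * cosh (median)], and
[`|x - y| / 2 <= e] by the triangle inequality. *)
Lemma hyperboloid_midpoint_convex p q m z :
  hdist p m = hdist p q / 2 -> hdist m q = hdist p q / 2 ->
  hdist z m <= (hdist z p + hdist z q) / 2.
Proof.
move=> hp hq; have := hyperboloid_median z hp hq.
rewrite coshD_prod -mulrA => /(mulfI (lt0r_neq0 (ltr0n _ 2))) h.
rewrite -ler_cosh ?divr_ge0 ?addr_ge0 ?hdist_ge0 //.
have C1 := cosh_ge1 (hdist p q / 2).
rewrite -(ler_pM2l (lt_le_trans ltr01 C1)) -h mulrC ler_pM2r; last first.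
  exact: lt_le_trans (cosh_ge1 _).
rewrite -cosh_norm ler_cosh ?normr_ge0 ?divr_ge0 ?hdist_ge0 //.
rewrite normrM [`|2^-1|]ger0_norm ?invr_ge0 // ler_pM2r ?invr_gt0 //.
have t2 := hdist_triangle p z q; have t3 := hdist_triangle q z p.
by rewrite (hdist_sym q p) in t3; rewrite ler_norml; apply/andP; split; lra.
Qed.

Variables (k : R) (hk : k < 0).
Let kap := Num.sqrt (- k).

Let kap_gt0 : 0 < kap.
Proof. by rewrite sqrtr_gt0 oppr_gt0. Qed.

Let hdistE (u v : hyperbolic_plane hk) : hdist u v = kap * mdist u v.
Proof. by rewrite -[mdist u v]/(hdist u v / kap) mulrC divfK ?gt_eqF. Qed.

Let hyperbolic_midpoint (p q m : hyperbolic_plane hk) : midpoint p q m ->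
  hdist p m = hdist p q / 2 /\ hdist m q = hdist p q / 2.
Proof. by case=> hp hq; rewrite !hdistE hp hq !mulrA. Qed.

Lemma hyperbolic_midpoint_convex : midpoint_convex (hyperbolic_plane hk).
Proof.
move=> p q m z /hyperbolic_midpoint[hp hq].
have := hyperboloid_midpoint_convex z hp hq.
by rewrite !hdistE -mulrDr -mulrA ler_pM2l.
Qed.

(** The factor [2 / kap] is there for [gauge_ge_id]: it makes the gauge at least
[expR (kap * r) / kap]. *)
Definition hyperbolic_gauge (r : R) : R := 2 / kap * cosh (kap * r).

Lemma hyperbolic_gaugeP : gauge hyperbolic_gauge.
Proof.
split=> [r|r s r0 rs|r r0].
- apply: cvgM; first exact: cvg_cst.
  apply: (@continuous_comp _ _ _ ( *%R kap)); last exact: cosh_continuous.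
  exact: mulrl_continuous.
- rewrite /hyperbolic_gauge ler_pM2l ?divr_gt0 //.
  by rewrite ler_cosh ?mulr_ge0 ?(ltW kap_gt0) ?(le_trans r0) // ler_pM2l.
- rewrite /hyperbolic_gauge /cosh.
  have e1 := expR_ge1Dx (kap * r); have e2 := expR_gt0 (- (kap * r)).
  have -> : 2 / kap * ((expR (kap * r) + expR (- (kap * r))) / 2) =
    (expR (kap * r) + expR (- (kap * r))) / kap by field; rewrite gt_eqF.
  by rewrite ler_pdivlMr // mulrC; lra.
Qed.

(** By the median formula, passing to the midpoint divides the mean of the two
hyperbolic cosines, which is at least 1, by at least [C0 > 1]. *)
Lemma hyperbolic_uniformly_convex :
  midpoint_uniformly_convex (hyperbolic_plane hk) hyperbolic_gauge.
Proof.
move=> e e0; set C0 := cosh (kap * e / 2).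
have C01 : 1 < C0.
  apply: le_lt_trans (cosh_ge1 0) _.
  by rewrite ltr_cosh // divr_gt0 // mulr_gt0.
exists (2 / kap * (1 - C0^-1)) => [|p q m z mpq epq].
  by rewrite mulr_gt0 ?divr_gt0 // subr_gt0 invf_lt1 //; lra.
have [hp hq] := hyperbolic_midpoint mpq.
have := hyperboloid_median z hp hq.
rewrite /hyperbolic_gauge; set c := 2 / kap.
rewrite -(mulrDr c) -(mulrA c) -(mulrBr c) ler_pM2l ?divr_gt0 // -!hdistE.
have : C0 <= cosh (hdist p q / 2).
  rewrite ler_cosh ?divr_ge0 ?mulr_ge0 ?(ltW kap_gt0) ?(ltW e0) ?hdist_ge0 //.
  by rewrite ler_pM2r ?invr_gt0 // hdistE ler_pM2l.
have := cosh_ge1 (hdist z p); have := cosh_ge1 (hdist z q).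
move: (cosh _) (cosh _) (cosh _) (cosh _) => w C y x x1 y1 C0C h.
have -> : w = (y + x) / 2 / C by rewrite h; field; lra.
set S := (y + x) / 2.
have S1 : 1 <= S by rewrite /S; lra.
have CV : C^-1 <= C0^-1 by rewrite lef_pV2 // posrE; lra.
have C0V : C0^-1 < 1 by rewrite invf_lt1 //; lra.
by nra.
Qed.

End Hyperbolic.

Lemma model_plane_gauge (R : realType) (k : R) : k <= 0 ->
  midpoint_convex (model_plane k) /\
  exists2 G, gauge G & midpoint_uniformly_convex (model_plane k) G.
Proof.
rewrite le_eqVlt => /predU1P[->|hk].
  rewrite model_plane0; split; first exact: euclid_midpoint_convex.
  by exists (fun r => 1 + r ^+ 2); [exact: euclid_gauge|
    exact: euclid_uniformly_convex].
rewrite (model_plane_lt0 hk); split; first exact: hyperbolic_midpoint_convex.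
by exists (hyperbolic_gauge k); [exact: hyperbolic_gaugeP|
  exact: hyperbolic_uniformly_convex].
Qed.

(** * Transfer to a space of nonpositive curvature *)

Section Comparison.
Variables (R : realType) (k : R) (X : metricType R).

Lemma geodesic_midpoint (M : metricType R) (p q : M) (c : R -> M) :
  geodesic p q c -> midpoint p q (c (mdist p q / 2)).
Proof.
case=> c0 cd iso; have d0 := mdist_ge0 p q.
split; [rewrite -{1}c0|rewrite -{2}cd]; rewrite iso ?in_itv /= ?lexx ?d0 //;
  try lra.
- by rewrite sub0r normrN ger0_norm // divr_ge0.
- by rewrite ler0_norm; [field|lra].
Qed.

(** The comparison triangle depends on [z], the point [m] does not: [m] lies on
one geodesic from [p] to [q], which serves as a side of all the triangles. *)
Lemma CAT_midpoint_comparison (p q : X) : CAT k X ->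
  exists m, forall z, exists p' q' m' z' : model_plane k,
    [/\ midpoint p' q' m', mdist p' q' = mdist p q, mdist z' p' = mdist z p,
        mdist z' q' = mdist z q & mdist z m <= mdist z' m'].
Proof.
case=> geoX catX; have [c gc] := geoX p q.
exists (c (mdist p q / 2)) => z.
have [c1 gc1] := geoX q z; have [c2 gc2] := geoX z p.
pose v (i : 'I_3) := match val i with 0%N => p | 1%N => q | _ => z end.
pose s (i : 'I_3) := match val i with 0%N => c | 1%N => c1 | _ => c2 end.
have vs i : geodesic (v i) (v (ordS i)) (s i) by case: i => -[|[|[|//]]] hi.
have [T' [eqT leT]] := catX (GeodesicTriangle vs).
pose i0 := @Ordinal 3 0 isT; pose i1 := @Ordinal 3 1 isT.
pose i2 := @Ordinal 3 2 isT.
have o0 : ordS i0 = i1 by apply: val_inj.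
have o1 : ordS i1 = i2 by apply: val_inj.
have o2 : ordS i2 = i0 by apply: val_inj.
have := eqT i0; have := eqT i1; have := eqT i2.
rewrite /side_length /= o0 o1 o2 /= => e2 e1 e0.
have := geodesic_midpoint (sideP T' i0); rewrite o0 e0 => mid'.
exists (vertex T' i0), (vertex T' i1), (side T' i0 (mdist p q / 2)), (vertex T' i2).
split=> //; first by rewrite metric_sym e1 metric_sym.
have := leT i0 i2 (mdist p q / 2) 0; rewrite /side_length /= o0 o2 /=.
have [-> _ _] := sideP T' i2; rewrite /s /v /= (metric_sym (c _)).
have [-> _ _] := gc2; rewrite (metric_sym (side T' _ _)); apply.
  by rewrite in_itv /=; have := mdist_ge0 p q; lra.
by rewrite in_itv /= lexx mdist_ge0.
Qed.

Lemma CAT_midpoint_map (G : R -> R) : k <= 0 -> CAT k X -> gauge G ->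
  midpoint_convex (model_plane k) ->
  midpoint_uniformly_convex (model_plane k) G ->
  exists mid : X -> X -> X,
    (forall p q z, mdist z (mid p q) <= (mdist z p + mdist z q) / 2) /\
    (forall e : R, 0 < e -> exists2 eta : R, 0 < eta & forall p q z, e <= mdist p q ->
      G (mdist z (mid p q)) <= (G (mdist z p) + G (mdist z q)) / 2 - eta).
Proof.
move=> k0 catX gG cvx ucvx.
have [mid midP] :=
  choice (fun pq : X * X => CAT_midpoint_comparison pq.1 pq.2 catX).
exists (fun p q => mid (p, q)); split=> [p q z|e /ucvx[eta eta0 h]].
  have [p' [q' [m' [z' [pqm _ <- <- le]]]]] := midP (p, q) z.
  exact: le_trans le (cvx _ _ _ _ pqm).
exists eta => // p q z epq.
have [p' [q' [m' [z' [pqm pq <- <- le]]]]] := midP (p, q) z.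
apply: le_trans (h _ _ _ _ pqm _); last by rewrite pq.
apply: (gauge_le gG) le; exact: mdist_ge0.
Qed.

End Comparison.

(** * Minimization on a complete space *)

Section Minimizer.
Variables (R : realType) (X : metricType R) (mid : X -> X -> X).

(** Two points at which [F] is close to its infimum are close to each other,
for otherwise [F] would fall below the infimum at their midpoint; so a
minimizing sequence is Cauchy. *)
Lemma uniformly_convex_argmin (F : X -> R) : complete_metric X ->
  [set: X] !=set0 -> continuous F -> (forall x, 0 <= F x) ->
  (forall e : R, 0 < e -> exists2 eta : R, 0 < eta & forall p q, e <= mdist p q ->
    F (mid p q) <= (F p + F q) / 2 - eta) ->
  exists x, forall z, F x <= F z.
Proof.
move=> cX [x0 _] cF F0 ucF; pose I := inf (range F).
have lbF : has_lbound (range F) by exists 0 => _ [x _ <-].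
have leI z : I <= F z by apply: ge_inf => //; exists z.
have [c [c_gt0 c_lt]] : exists c : nat -> R, (forall n, 0 < c n) /\
    forall e, 0 < e -> exists N, forall n, (N <= n)%N -> c n < e.
  exists (fun n => n.+1%:R^-1); split=> [n|e e0]; first by rewrite invr_gt0.
  have [N _ NP] := near_infty_natSinv_lt (PosNum e0).
  by exists N => n /NP.
have minseq n : exists x, F x < I + c n.
  have [|_ [x _ <-] xI] := @inf_adherent _ (range F) _ (c_gt0 n); last by exists x.
  by split=> //; exists (F x0), x0.
have [u uI] := choice minseq.
have cu : cauchy (u @ \oo).
  apply: cauchy_exP => e e0; have [eta eta0 ucv] := ucF e e0.
  have [N NP] := c_lt _ eta0; exists (u N); exists N => // n /= Nn.
  rewrite ballEmdist /= ltNge; apply/negP => /ucv.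
  have := leI (mid (u N) (u n)); have := uI N; have := uI n.
  have := NP N (leqnn N); have := NP n Nn; lra.
have [x ux] := cX u cu; exists x => z; rewrite leNgt; apply/negP => zx.
have e0 : 0 < (F x - F z) / 2 by lra.
have Fu : F (u n) @[n --> \oo] --> F x by apply: continuous_cvg ux; exact: cF.
have [N NP] := c_lt _ e0.
have /cvgrPdist_lt/(_ _ e0)[M _ MP] := Fu.
have := MP (maxn N M) (leq_maxr _ _); have := NP (maxn N M) (leq_maxl _ _).
have := uI (maxn N M); have := leI z.
by rewrite /= ltr_norml => zI nI ne /andP[_ +]; lra.
Qed.

End Minimizer.

Lemma nbhs_mdistE (R : realType) (T : metricType R) (x : T) (P : set T) :
  nbhs x P <-> exists2 r : R, 0 < r & forall y, mdist x y < r -> P y.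
Proof.
rewrite -metricType_numDomainType.filter_from_mdist_nbhs.
by split=> -[r r0 rP]; exists r.
Qed.

Lemma metric_continuous (R : realType) (S T : metricType R) (f : S -> T) :
  (forall x e, 0 < e -> exists2 r : R, 0 < r &
    forall y, mdist x y < r -> mdist (f x) (f y) < e) -> continuous f.
Proof.
move=> h x; apply/metricType_numDomainType.cvgrPdist_lt => e /(h x)[r r0 rP].
by apply/nbhs_mdistE; exists r.
Qed.

(** * The functional whose minimizers extend the inverse of the embedding *)

Section Extension.
Variables (R : realType) (X Y : metricType R) (h : X -> Y) (x0 : X).

Definition set_dist (y : Y) : R := inf (range (fun b => mdist y (h b))).

Local Notation delta := set_dist.

Let has_lb y : has_lbound (range (fun b => mdist y (h b))).
Proof. by exists 0 => _ [b _ <-]; exact: mdist_ge0. Qed.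

Lemma set_dist_le y b : delta y <= mdist y (h b).
Proof. by apply: ge_inf => //; exists b. Qed.

Lemma le_set_dist y r : (forall b, r <= mdist y (h b)) -> r <= delta y.
Proof.
move=> hr; apply: lb_le_inf; first by exists (mdist y (h x0)), x0.
by move=> _ [b _ <-].
Qed.

Lemma set_dist_ge0 y : 0 <= delta y.
Proof. by apply: le_set_dist => b; exact: mdist_ge0. Qed.

Lemma set_dist_lt y e : 0 < e -> exists b, mdist y (h b) < delta y + e.
Proof.
move=> e0; have [|_ [b _ <-] hb] :=
  @inf_adherent _ (range (fun b => mdist y (h b))) e e0; last by exists b.
by split=> //; exists (mdist y (h x0)), x0.
Qed.

Lemma set_dist_lipschitz y y' : delta y <= delta y' + mdist y y'.
Proof.
rewrite -lerBlDr; apply: le_set_dist => b.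
have := set_dist_le y b; have := metric_triangle y y' (h b); lra.
Qed.

Lemma set_dist_gt0 y : closed (range h) -> ~ range h y -> 0 < delta y.
Proof.
move=> clh yh; rewrite lt_neqAle set_dist_ge0 andbT; apply/negP => /eqP d0.
apply: yh; apply: clh => B.
move=> /nbhs_mdistE[r r0 rB].
have [b hb] := set_dist_lt y r0; exists (h b); split; first by exists b.
by apply: rB; rewrite /= -[r]add0r d0.
Qed.

(** The cut-off at twice the distance is continuous in [y] without any division
by [set_dist y], so that all weights are Lipschitz in [y] with constant 3. *)
Definition weight (y : Y) (b : X) : R :=
  Num.max 0 (2 * delta y - mdist y (h b)) / (1 + mdist x0 b).

Definition weighted_sup (y : Y) (x : X) : R :=
  sup (range (fun b => weight y b * mdist x b)).

Let den_gt0 b : 0 < 1 + mdist x0 b.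
Proof. by rewrite ltr_pwDl // mdist_ge0. Qed.

Lemma weight_ge0 y b : 0 <= weight y b.
Proof. by rewrite divr_ge0 ?(ltW (den_gt0 b)) // le_max lexx. Qed.

Lemma weight_le y b : weight y b <= delta y.
Proof.
rewrite ler_pdivrMr // ge_max; have d0 := set_dist_ge0 y.
have db := set_dist_le y b; have b0 := mdist_ge0 x0 b.
by apply/andP; split; nra.
Qed.

(* The growth of the distance to b is compensated by the denominator of the
   weight: this is what bounds the supremum, uniformly in b. *)
Let normalized_dist x b : mdist x b / (1 + mdist x0 b) <= 1 + mdist x0 x.
Proof.
rewrite ler_pdivrMr //; have t := metric_triangle x x0 b.
rewrite (metric_sym x x0) in t.
have b0 := mdist_ge0 x0 b; have a0 := mdist_ge0 x0 x; nra.
Qed.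

Lemma weight_dist_lipschitz y y' x b :
  weight y b * mdist x b <=
  weight y' b * mdist x b + 3 * mdist y y' * (1 + mdist x0 x).
Proof.
rewrite /weight !(mulrAC _ (_^-1)) -!mulrA.
have n0 : 0 <= mdist x b / (1 + mdist x0 b).
  by rewrite divr_ge0 ?mdist_ge0 // ltW.
have n1 := normalized_dist x b.
move: (_ / _) n0 n1 => n n0 n1.
have h1 : Num.max 0 (2 * delta y - mdist y (h b)) <=
    Num.max 0 (2 * delta y' - mdist y' (h b)) + 3 * mdist y y'.
  have l := set_dist_lipschitz y y'; have t := metric_triangle y' y (h b).
  rewrite (metric_sym y' y) in t; have y0 := mdist_ge0 y y'.
  have m1 : 2 * delta y' - mdist y' (h b) <=
    Num.max 0 (2 * delta y' - mdist y' (h b)) by rewrite le_max lexx orbT.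
  have m0 : 0 <= Num.max 0 (2 * delta y' - mdist y' (h b)) by rewrite le_max lexx.
  by rewrite ge_max; apply/andP; split; lra.
have y0 := mdist_ge0 y y'.
apply: (le_trans (ler_wpM2r n0 h1)).
by rewrite mulrDl lerD2l -!mulrA ler_pM2l // ler_wpM2l.
Qed.

Let weight_dist_le y x b : weight y b * mdist x b <= delta y * (1 + mdist x0 x).
Proof.
rewrite /weight mulrAC -mulrA; apply: ler_pM.
- by rewrite le_max lexx.
- by rewrite divr_ge0 ?mdist_ge0 // ltW.
- rewrite ge_max set_dist_ge0 /=; have := set_dist_le y b; lra.
- exact: normalized_dist.
Qed.

Lemma le_weighted_sup y x b : weight y b * mdist x b <= weighted_sup y x.
Proof.
apply: ub_le_sup; last by exists b.
by exists (delta y * (1 + mdist x0 x)) => _ [c _ <-].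
Qed.

Lemma weighted_sup_le y x C : (forall b, weight y b * mdist x b <= C) ->
  weighted_sup y x <= C.
Proof.
move=> hC; apply: ge_sup; first by exists (weight y x0 * mdist x x0), x0.
by move=> _ [b _ <-].
Qed.

Lemma weighted_sup_ge0 y x : 0 <= weighted_sup y x.
Proof.
apply: le_trans (le_weighted_sup y x x0).
by rewrite mulr_ge0 ?weight_ge0 ?mdist_ge0.
Qed.

Lemma weighted_sup_bound y x : weighted_sup y x <= delta y * (1 + mdist x0 x).
Proof. exact: weighted_sup_le. Qed.

Lemma weighted_sup_lipschitzl y y' x : weighted_sup y x <=
  weighted_sup y' x + 3 * mdist y y' * (1 + mdist x0 x).
Proof.
apply: weighted_sup_le => b; apply: le_trans (weight_dist_lipschitz y y' x b) _.
by rewrite lerD2r le_weighted_sup.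
Qed.

Lemma weighted_sup_lipschitzr y x x' : weighted_sup y x <=
  weighted_sup y x' + delta y * mdist x x'.
Proof.
apply: weighted_sup_le => b.
apply: (@le_trans _ _ (weight y b * mdist x' b + weight y b * mdist x x')).
  rewrite -mulrDr ler_wpM2l ?weight_ge0 // addrC; exact: metric_triangle.
by rewrite lerD ?le_weighted_sup // ler_wpM2r ?mdist_ge0 ?weight_le.
Qed.

Variables (mid : X -> X -> X) (G : R -> R).
Hypothesis mid_convex :
  forall p q z, mdist z (mid p q) <= (mdist z p + mdist z q) / 2.
Hypothesis gaugeG : gauge G.
Hypothesis G_uniformly_convex :
  forall e : R, 0 < e -> exists2 eta : R, 0 < eta & forall p q z, e <= mdist p q ->
    G (mdist z (mid p q)) <= (G (mdist z p) + G (mdist z q)) / 2 - eta.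

Lemma weighted_sup_convex y p q : weighted_sup y (mid p q) <=
  (weighted_sup y p + weighted_sup y q) / 2.
Proof.
apply: weighted_sup_le => b.
apply: (@le_trans _ _ ((weight y b * mdist p b + weight y b * mdist q b) / 2)).
  rewrite -mulrDr -mulrA ler_wpM2l ?weight_ge0 //.
  by rewrite metric_sym (metric_sym p) (metric_sym q).
by rewrite ler_pM2r ?invr_gt0 // lerD ?le_weighted_sup.
Qed.

(** The square makes the regularizing term negligible, near the image, with
respect to the supremum, whose size is of order [delta y]. *)
Definition functional (y : Y) (x : X) : R :=
  delta y ^+ 2 * G (mdist x0 x) + weighted_sup y x.

Let G_ge0 x : 0 <= G (mdist x0 x).
Proof. exact: le_trans (mdist_ge0 _ _) (gauge_ge_id gaugeG (mdist_ge0 _ _)). Qed.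

Lemma functional_ge0 y x : 0 <= functional y x.
Proof. by rewrite addr_ge0 ?weighted_sup_ge0 // mulr_ge0 ?sqr_ge0. Qed.

Lemma functional_continuous y : continuous (functional y).
Proof.
move=> x; apply: cvgD.
  apply: cvgM; first exact: cvg_cst.
  apply: (@continuous_comp _ _ _ (mdist x0));
    last exact: (gauge_continuous gaugeG).
  apply/cvgrPdist_lt => e e0; near=> z.
  have : mdist x z < e by near: z; apply/nbhs_mdistE; exists e.
  have := metric_triangle x0 x z; have := metric_triangle x0 z x.
  by rewrite (metric_sym z x) ltr_norml => *; apply/andP; split; lra.
apply/cvgrPdist_lt => e e0.
have d1 : 0 < delta y + 1 by rewrite ltr_wpDl ?set_dist_ge0.
have ed : 0 < e / (delta y + 1) by rewrite divr_gt0.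
near=> z.
have : mdist x z < e / (delta y + 1).
  by near: z; apply/nbhs_mdistE; exists (e / (delta y + 1)).
rewrite ltr_pdivlMr // => hz.
have := weighted_sup_lipschitzr y x z; have := weighted_sup_lipschitzr y z x.
rewrite (metric_sym z x) ltr_norml; have := mdist_ge0 x z.
by move=> *; apply/andP; split; nra.
Unshelve. all: by end_near. Qed.

Lemma functional_uniformly_convex y e : 0 < delta y -> 0 < e ->
  exists2 eta : R, 0 < eta & forall p q, e <= mdist p q ->
    functional y (mid p q) <=
      (functional y p + functional y q) / 2 - delta y ^+ 2 * eta.
Proof.
move=> d0 /G_uniformly_convex[eta eta0 hG]; exists eta => // p q /(hG p q x0).
rewrite -(ler_pM2l (exprn_gt0 2 d0)) /functional.
have := weighted_sup_convex y p q; lra.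
Qed.

Definition argmin (y : Y) (x : X) : Prop :=
  forall z, functional y x <= functional y z.

Lemma argmin_exists y : complete_metric X -> 0 < delta y -> exists x, argmin y x.
Proof.
move=> cX d0.
apply: (uniformly_convex_argmin cX _ (@functional_continuous y) (functional_ge0 y)).
  by exists x0.
move=> e /(functional_uniformly_convex d0)[eta eta0 he].
exists (delta y ^+ 2 * eta); last exact: he.
by rewrite mulr_gt0 ?exprn_gt0.
Qed.

(** Comparison with the value at [x0]. *)
Lemma argmin_bound y x : 0 < delta y -> argmin y x ->
  G (mdist x0 x) <= G 0 + (delta y)^-1.
Proof.
move=> d0 /(_ x0); rewrite /functional mdistxx => le.
have := weighted_sup_bound y x0; rewrite mdistxx addr0 mulr1 => ub.
have lb := weighted_sup_ge0 y x.
rewrite -(ler_pM2l (exprn_gt0 2 d0)).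
have -> : delta y ^+ 2 * (G 0 + (delta y)^-1) = delta y ^+ 2 * G 0 + delta y.
  by field; rewrite gt_eqF.
lra.
Qed.

Lemma functional_lipschitz y y' x B : G (mdist x0 x) <= B ->
  functional y x <= functional y' x +
    mdist y y' * ((delta y + delta y') * B + 3 * (1 + B)).
Proof.
move=> GB; have xB := le_trans (gauge_ge_id gaugeG (mdist_ge0 x0 x)) GB.
have G0 := G_ge0 x; have y0 := mdist_ge0 y y'.
have S := weighted_sup_lipschitzl y y' x.
have D := set_dist_lipschitz y y'.
have d0 := set_dist_ge0 y; have d0' := set_dist_ge0 y'.
have h1 : 3 * mdist y y' * (1 + mdist x0 x) <= 3 * mdist y y' * (1 + B).
  by rewrite ler_wpM2l ?mulr_ge0 // lerD2l.
have h2 : (delta y ^+ 2 - delta y' ^+ 2) * G (mdist x0 x) <=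
    mdist y y' * ((delta y + delta y') * B).
  rewrite subr_sqr -mulrA; apply: (@le_trans _ _ (mdist y y' *
    ((delta y + delta y') * G (mdist x0 x)))).
    by rewrite ler_wpM2r ?mulr_ge0 ?addr_ge0 //; lra.
  by rewrite ler_wpM2l // ler_wpM2l // addr_ge0.
rewrite /functional; lra.
Qed.

(** If the minimizers [x] and [x'] for [y] and [y'] were [e] apart, the midpoint
would save [delta y ^+ 2 * eta] in the functional of [y]; but the two
functionals differ, on bounded sets, by a multiple of [mdist y y'] only. *)
Lemma argmin_continuous_off y x e : 0 < delta y -> argmin y x -> 0 < e ->
  exists2 r : R, 0 < r & forall y' x', mdist y y' < r ->
    0 < delta y' /\ (argmin y' x' -> mdist x x' < e).
Proof.
move=> d0 xmin e0; have [eta eta0 uc] := functional_uniformly_convex d0 e0.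
set d := delta y in d0 uc *.
(* B bounds the gauge at the minimizers for all y' with delta y' >= d / 2 *)
pose B := G 0 + 2 / d.
have G00 : 0 <= G 0 by have := G_ge0 x0; rewrite mdistxx.
have B0 : 0 <= B by rewrite addr_ge0 // divr_ge0 // ltW.
(* 3 * d bounds delta y + delta y' in functional_lipschitz *)
pose K := 3 * d * B + 3 * (1 + B).
have K0 : 0 < K by rewrite ltr_wpDl ?mulr_ge0 ?(ltW d0) // mulr_gt0 // ltr_pwDl.
exists (Num.min (d / 2) (d ^+ 2 * eta / K)) => [|y' x'].
  by rewrite lt_min !divr_gt0 // mulr_gt0 // exprn_gt0.
rewrite lt_min => /andP[r1]; rewrite ltr_pdivlMr // => r2.
have D := set_dist_lipschitz y y'; have D' := set_dist_lipschitz y' y.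
rewrite -/d in D D'; rewrite (metric_sym y' y) in D'.
have d0' : 0 < delta y' by lra.
split=> // xmin'; rewrite ltNge; apply/negP => /uc hmid.
have b : d^-1 <= 2 / d by rewrite ler_peMl ?invr_ge0 ?(ltW d0) //; lra.
have b' : (delta y')^-1 <= 2 / d.
  by rewrite -[2 / d]invf_div lef_pV2 ?posrE ?divr_gt0 //; lra.
have GB : G (mdist x0 x) <= B by have := argmin_bound d0 xmin; rewrite /B -/d; lra.
have GB' : G (mdist x0 x') <= B by have := argmin_bound d0' xmin'; rewrite /B; lra.
have L := functional_lipschitz y' y GB; have L' := functional_lipschitz y y' GB'.
have m1 := xmin (mid x x'); have m2 := xmin' x.
have y0 := mdist_ge0 y y'.
have hK : mdist y y' * ((d + delta y') * B + 3 * (1 + B)) <= mdist y y' * K.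
  by rewrite ler_wpM2l // /K lerD2r ler_wpM2r //; lra.
rewrite (metric_sym y' y) (addrC (delta y')) -/d in L; rewrite -/d in L'.
lra.
Qed.

Hypothesis h_inverse_continuous : forall a e, 0 < e -> exists2 r : R, 0 < r &
  forall b, mdist (h a) (h b) < r -> mdist a b < e.

(** The functional of [y] is at most [2 eta * delta y] at [a].  A point [b] whose
image is within [3/2 * delta y] of [y] has a weight at least
[delta y / (2 (N + 1))], so a minimizer [x] is within [4 (N + 1) eta] of [b],
which itself is within [eta] of [a]. *)
Lemma argmin_continuous_on a e : 0 < e -> exists2 r : R, 0 < r &
  forall y x, mdist (h a) y < r -> 0 < delta y -> argmin y x -> mdist a x < e.
Proof.
move=> e0; set N := 1 + mdist x0 a.
have N1 : 1 <= N by rewrite lerDl mdist_ge0.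
pose eta := Num.min 1 (e / (2 * (5 + 4 * N))).
have eta0 : 0 < eta by rewrite lt_min ltr01 divr_gt0 // mulr_gt0 //; lra.
have eta1 : eta <= 1 by rewrite ge_min lexx.
have etae : (5 + 4 * N) * eta < e.
  have : eta <= e / (2 * (5 + 4 * N)) by rewrite ge_min lexx orbT.
  by rewrite ler_pdivlMr; lra.
have [r r0 rP] := h_inverse_continuous a eta0.
set Ga := G (mdist x0 a); have Ga0 : 0 <= Ga := G_ge0 a.
have Ga1 : 0 < 1 + Ga by lra.
exists (Num.min (r / 3) (eta / (1 + Ga))) => [|y x].
  by rewrite lt_min !divr_gt0.
rewrite lt_min ltr_pdivlMr // ltr_pdivlMr // => /andP[yr yG] d0 xmin.
have dy := set_dist_le y a; rewrite metric_sym in dy.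
have near_a b : mdist y (h b) < 2 * delta y -> mdist a b < eta.
  by move=> hb; apply: rP; have := metric_triangle (h a) y (h b); lra.
have Sa : weighted_sup y a <= delta y * eta.
  apply: weighted_sup_le => b.
  case: (ltP (mdist y (h b)) (2 * delta y)) => [/near_a/ltW ab|far].
    by apply: ler_pM; rewrite ?weight_ge0 ?mdist_ge0 ?weight_le.
  rewrite /weight max_l ?subr_le0 // !mul0r mulr_ge0 //; exact: ltW.
have Pa : functional y a <= delta y * (2 * eta).
  have : delta y * (delta y * Ga) <= delta y * eta.
    by rewrite ler_wpM2l ?(ltW d0) //; nra.
  by rewrite /functional -/Ga expr2; lra.
have d2 : 0 < delta y / 2 by rewrite divr_gt0.
have [b hb] := set_dist_lt y d2.
have ab : mdist a b < eta by apply: near_a; lra.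
have bN : 1 + mdist x0 b <= N + 1.
  by have := metric_triangle x0 a b; rewrite /N; lra.
have wb : delta y / 2 <= weight y b * (N + 1).
  apply: (@le_trans _ _ (weight y b * (1 + mdist x0 b))); last first.
    by rewrite ler_wpM2l ?weight_ge0.
  by rewrite divfK ?gt_eqF // le_max; apply/orP; right; lra.
have xb : weight y b * mdist x b <= delta y * (2 * eta).
  apply: le_trans (le_trans (xmin a) Pa); apply: le_trans (le_weighted_sup y x b) _.
  by rewrite lerDr mulr_ge0 ?sqr_ge0.
have {}xb : mdist x b <= 4 * (N + 1) * eta.
  rewrite -(ler_pM2l d2); apply: (@le_trans _ _ (weight y b * (N + 1) * mdist x b)).
    by rewrite ler_wpM2r ?mdist_ge0.
  rewrite mulrAC; apply: (@le_trans _ _ (delta y * (2 * eta) * (N + 1))).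
    by rewrite ler_wpM2r //; lra.
  by rewrite le_eqVlt; apply/orP; left; apply/eqP; field.
by have := metric_triangle a b x; rewrite (metric_sym b x); lra.
Qed.

Lemma continuous_left_inverse : complete_metric X -> closed (range h) ->
  exists2 f : Y -> X, continuous f & cancel h f.
Proof.
move=> cX clh.
have h_inj a b : h a = h b -> a = b.
  move=> ab; apply: contrapT => /eqP; rewrite -mdist_gt0 => ab0.
  have [r r0 /(_ b)] := h_inverse_continuous a ab0.
  by rewrite ab mdistxx ltxx => /(_ r0).
have delta0 a : delta (h a) = 0.
  by apply/eqP; rewrite eq_le set_dist_ge0 andbT -(mdistxx (h a)) set_dist_le.
have /choice[f fP] y : exists x, (forall a, h a = y -> x = a) /\
    (0 < delta y -> argmin y x).
  have [[a _ <-]|/(set_dist_gt0 clh) d0] := pselect (range h y).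
    by exists a; rewrite delta0 ltxx; split=> // b /h_inj.
  have [x xmin] := argmin_exists cX d0; exists x; split=> // a ay.
  by move: d0; rewrite -ay delta0 ltxx.
exists f => [|a]; last exact: (fP (h a)).1.
apply: metric_continuous => y e e0.
have [[a _ <-]|/(set_dist_gt0 clh) d0] := pselect (range h y).
  rewrite ((fP _).1 a) //.
  have [r1 r10 r1P] := h_inverse_continuous a e0.
  have [r2 r20 r2P] := argmin_continuous_on a e0.
  exists (Num.min r1 r2) => [|y']; first by rewrite lt_min r10.
  rewrite lt_min => /andP[y1 y2].
  have [[b _ by']|/(set_dist_gt0 clh) d0'] := pselect (range h y').
    by rewrite ((fP y').1 b) //; apply: r1P; rewrite by'.
  by apply: (r2P y') => //; exact: (fP y').2.
have [r r0 rP] := argmin_continuous_off d0 ((fP y).2 d0) e0.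
exists r => // y' /(rP y' (f y'))[d0']; apply; exact: (fP y').2.
Qed.

End Extension.

(** * Retraction onto a closed embedded copy *)

Lemma embedding_inverse_continuous (R : realType) (X Y : metricType R)
    (h : X -> Y) : is_embedding h ->
  forall a e, 0 < e -> exists2 r : R, 0 < r &
    forall b, mdist (h a) (h b) < r -> mdist a b < e.
Proof.
case=> _ [g [cg hg gh]] a e e0.
have : nbhs (corestrict h a) [set t | mdist (g (corestrict h a)) (g t) < e].
  exact: metricType_numDomainType.cvgr_dist_lt (cg _) _ e0.
rewrite -filter_from_ballE => -[r r0 rP]; exists r => // b ab.
have := rP (corestrict h b); rewrite /= !hg; apply.
by rewrite -[ball _ _ _]/(ball (h a) r (h b)) ballEmdist.
Qed.

Unset Implicit Arguments.

Theorem theorem6 (R : realType) (k : R) (X : metricType R) :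
  k <= 0 -> [set: X] !=set0 -> complete_metric X -> CAT k X ->
  absolute_retract X.
Proof.
move=> k0 [x0 _] cX catX Y h hemb clh.
have [cvx [G gG ucvx]] := model_plane_gauge k0.
have [mid [midP GP]] := CAT_midpoint_map k0 catX gG cvx ucvx.
have [f cf fh] := continuous_left_inverse x0 midP gG GP
  (embedding_inverse_continuous hemb) cX clh.
exists (corestrict h \o f); split.
  move=> y; apply: continuous_comp; first exact: cf.
  exact: hemb.1.
move=> [_ /[dup] /set_mem [a _ <-] ha]; rewrite /= fh.
exact: val_inj.
Qed.
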